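(* Let $[x_k]$, $k\in[0,N]$, be the zero-mean Gaussian sequence governed by the forward Markov model $$x_0=e^M_0,\qquad x_k=M_{k,k-1}x_{k-1}+e^M_k,\quad k\in[1,N],$$ where $[e^M_k]$ is a zero-mean white nonsingular Gaussian sequence with covariances $M_k$ and the state transition matrices $M_{k,k-1}$ are arbitrary (singular or nonsingular). Then the parameters of a backward Markov model $$x_N=e^{MB}_N,\qquad x_k=M^B_{k,k+1}x_{k+1}+e^{MB}_k,\quad k\in[0,N-1],$$ for the same sequence, where $[e^{MB}_k]$ is a zero-mean white nonsingular Gaussian sequence with covariances $M^B_k$, are given by \begin{align*} (M_0^B)^{-1}&=M_0^{-1}+M_{1,0}'M_1^{-1}M_{1,0},\\ M_{0,1}^B&=M_0^BM_{1,0}'M_1^{-1},\\ (M_{k-1}^B)^{-1}&=M_{k-1}^{-1}+M_{k,k-1}'M_k^{-1}M_{k,k-1}-(M^B_{k-2,k-1})'(M^B_{k-2})^{-1}M^B_{k-2,k-1},\quad k=2,\ldots,N,\\ M^B_{k-1,k}&=M^B_{k-1}M_{k,k-1}'M_k^{-1},\quad k=2,\ldots,N,\\ (M^B_N)^{-1}&=M_N^{-1}-(M^B_{N-1,N})'(M^B_{N-1})^{-1}M^B_{N-1,N}. \end{align*} Moreover, the forward and backward models are explicitly sample-equivalent (they generate the same sample path of $[x_k]$) with the relationship between their dynamic noises and boundary values given by \begin{align*} (M^B_0)^{-1}e^{MB}_0&=M_0^{-1}e^M_0-M_{1,0}'M_1^{-1}e^M_1,\\ (M^B_k)^{-1}e^{MB}_k&=(M^B_{k-1,k})'(M^B_{k-1})^{-1}e^{MB}_{k-1}+M_k^{-1}e^M_k-M_{k+1,k}'M_{k+1}^{-1}e^M_{k+1},\quad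 k\in[1,N-1],\\ (M^B_N)^{-1}e^{MB}_N&=(M^B_{N-1,N})'(M^B_{N-1})^{-1}e^{MB}_{N-1}+M_N^{-1}e^M_N. \end{align*}
   Context: A prime denotes transpose, and $[i,j]=\{i,i+1,\ldots,j\}$, with $N\ge1$. Sequences take values in $\mathbb{R}^d$. A zero-mean white nonsingular Gaussian sequence with covariances $Q_k$ is a zero-mean Gaussian sequence over $[0,N]$ with $E[e_ke_j']=0$ for $k\neq j$ and $E[e_ke_k']=Q_k$ positive definite. The boundary value of the forward model is $e^M_0$ and that of the backward model is $e^{MB}_N$. Two models are explicitly sample-equivalent if, given a sample path of the dynamic noise and boundary values of one model for an arbitrary sample path of the governed sequence, a sample path of the dynamic noise and boundary values of the other model leading to the same sample path of the governed sequence is given explicitly. *)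

(* Defs.v *)
From mathcomp Require Import all_boot all_order all_algebra.
From mathcomp Require Import all_classical all_reals all_analysis.
Import Order.TTheory GRing.Theory Num.Theory.

Set Implicit Arguments.
Unset Strict Implicit.
Unset Printing Implicit Defensive.

Local Open Scope classical_set_scope.
Local Open Scope ring_scope.

(* Conventions.  A sequence over [0,N] is a function on nat of which only the
   indices k <= N are ever inspected.  The two-index transition matrices are
   stored under their first index:
     F k  is  M_{k,k-1}      (k = 1, ..., N),
     FB k is  M^B_{k,k+1}    (k = 0, ..., N-1). *)

Definition posdefmx (R : realType) (d : nat) (Q : 'M[R]_d) : Prop :=
  Q^T = Q /\ forall v : 'cV[R]_d, v != 0 -> 0 < (v^T *m Q *m v) 0 0.

(* [normal_prob m s] has standard deviation s; for s = 0 it is not the point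
   mass at m, so the degenerate normal law is added by hand. *)
Definition normal_law (R : realType) (m s : R) (A : set (measurableTypeR R)) :
    \bar R :=
  if s == 0 then \d_m A else normal_prob m s A.

(* Joint Gaussianity: every linear combination of the components of
   e_0, ..., e_N has a (possibly degenerate) normal law. *)
Definition gaussian_sequence (R : realType) (d : nat)
    (disp : measure_display) (T : measurableType disp) (P : probability T R)
    (N : nat) (e : nat -> T -> 'cV[R]_d) : Prop :=
  (forall k, (k <= N)%N -> forall i : 'I_d,
     measurable_fun [set: T] (fun w => e k w i 0)) /\
  (forall c : nat -> 'cV[R]_d, exists m s : R,
     forall A : set (measurableTypeR R), measurable A ->
       P ((fun w => \sum_(k < N.+1) ((c k)^T *m e k w) 0 0) @^-1` A)
       = normal_law m s A).

Definition zero_mean_white_nonsingular_gaussian (R : realType) (d : nat)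
    (disp : measure_display) (T : measurableType disp) (P : probability T R)
    (N : nat) (e : nat -> T -> 'cV[R]_d) (Q : nat -> 'M[R]_d) : Prop :=
  [/\ gaussian_sequence P N e,
      forall k, (k <= N)%N -> forall i : 'I_d,
        ('E_P[fun w => (e k w i 0)%R] = 0)%E,
      forall k j, (k <= N)%N -> (j <= N)%N -> k != j -> forall i l : 'I_d,
        ('E_P[fun w => ((e k w *m (e j w)^T) i l)%R] = 0)%E,
      forall k, (k <= N)%N -> forall i l : 'I_d,
        ('E_P[fun w => ((e k w *m (e k w)^T) i l)%R] = (Q k i l)%:E)%E
    & forall k, (k <= N)%N -> posdefmx (Q k)].

(* The next three definitions are about sample paths.  The boundary value e_0
   (resp. eB_N) is part of the noise path. *)

Definition forward_governs (R : realType) (d N : nat) (F : nat -> 'M[R]_d)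
    (e x : nat -> 'cV[R]_d) : Prop :=
  x 0%N = e 0%N /\
  forall k, (1 <= k <= N)%N -> x k = F k *m x k.-1 + e k.

Definition backward_governs (R : realType) (d N : nat) (FB : nat -> 'M[R]_d)
    (eB x : nat -> 'cV[R]_d) : Prop :=
  x N = eB N /\
  forall k, (k < N)%N -> x k = FB k *m x k.+1 + eB k.

Definition noise_relation (R : realType) (d N : nat)
    (M F MB FB : nat -> 'M[R]_d) (e eB : nat -> 'cV[R]_d) : Prop :=
  [/\ invmx (MB 0%N) *m eB 0%N
        = invmx (M 0%N) *m e 0%N - (F 1%N)^T *m invmx (M 1%N) *m e 1%N,
      forall k, (1 <= k < N)%N ->
        invmx (MB k) *m eB k
          = (FB k.-1)^T *m invmx (MB k.-1) *m eB k.-1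
            + invmx (M k) *m e k - (F k.+1)^T *m invmx (M k.+1) *m e k.+1
    & invmx (MB N) *m eB N
        = (FB N.-1)^T *m invmx (MB N.-1) *m eB N.-1 + invmx (M N) *m e N].

(* Two models, given by which noise paths govern which sample paths, are
   explicitly sample-equivalent through [rel]: given an arbitrary sample path x
   and a noise path of one model generating it, the formula [rel] determines a
   unique noise path over [0,N] of the other model, and the latter generates
   the same x. *)
Definition explicitly_sample_equivalent (V : Type) (N : nat)
    (gov1 gov2 rel : (nat -> V) -> (nat -> V) -> Prop) : Prop :=
  (forall x e1, gov1 e1 x ->
     exists e2, [/\ rel e1 e2, gov2 e2 x &
       forall e2', rel e1 e2' -> forall k, (k <= N)%N -> e2' k = e2 k]) /\
  (forall x e2, gov2 e2 x ->
     exists e1, [/\ rel e1 e2, gov1 e1 x &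
       forall e1', rel e1' e2 -> forall k, (k <= N)%N -> e1' k = e1 k]).

Definition forward_markov_model (R : realType) (d : nat)
    (disp : measure_display) (T : measurableType disp) (P : probability T R)
    (N : nat) (M F : nat -> 'M[R]_d) (eM x : nat -> T -> 'cV[R]_d) : Prop :=
  zero_mean_white_nonsingular_gaussian P N eM M /\
  forall w : T, forward_governs N F (eM^~ w) (x^~ w).

Definition backward_markov_model (R : realType) (d : nat)
    (disp : measure_display) (T : measurableType disp) (P : probability T R)
    (N : nat) (MB FB : nat -> 'M[R]_d) (eMB x : nat -> T -> 'cV[R]_d) : Prop :=
  zero_mean_white_nonsingular_gaussian P N eMB MB /\
  forall w : T, backward_governs N FB (eMB^~ w) (x^~ w).

Definition backward_parameters (R : realType) (d N : nat)
    (M F MB FB : nat -> 'M[R]_d) : Prop :=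
  [/\ invmx (MB 0%N) = invmx (M 0%N) + (F 1%N)^T *m invmx (M 1%N) *m F 1%N,
      FB 0%N = MB 0%N *m (F 1%N)^T *m invmx (M 1%N),
      forall k, (2 <= k <= N)%N ->
        invmx (MB k.-1)
          = invmx (M k.-1) + (F k)^T *m invmx (M k) *m F k
            - (FB k.-2)^T *m invmx (MB k.-2) *m FB k.-2,
      forall k, (2 <= k <= N)%N ->
        FB k.-1 = MB k.-1 *m (F k)^T *m invmx (M k)
    & invmx (MB N)
        = invmx (M N) - (FB N.-1)^T *m invmx (MB N.-1) *m FB N.-1].

(* Main.v *)
Require Import Defs.
From mathcomp Require Import all_boot all_order all_algebra.
From mathcomp Require Import all_classical all_reals all_analysis.
Import Order.TTheory GRing.Theory Num.Theory.
Set Implicit Arguments.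
Unset Strict Implicit.
Unset Printing Implicit Defensive.
Local Open Scope ring_scope.

(** Let [C_k] be the covariance of [x_k], so that [C_(k+1) = F C_k F' + M] with
    [F = M_(k+1,k)] and [M = M_(k+1)].  In a backward model [e^MB_k] is orthogonal
    to [x_j] for [j > k], hence
      [FB_k C_(k+1) = C_k F'] and [C_k = FB_k F C_k + MB_k],
    which forces [MB_k^-1 = C_k^-1 + F' M^-1 F] and [FB_k = MB_k F' M^-1]; the
    recursion for [MB_k] then follows from
      [C_(k+1)^-1 = M^-1 - FB_k' MB_k^-1 FB_k].
    Conversely, for these parameters [e^MB_k := x_k - FB_k x_(k+1)] is white, and
    it is Gaussian because its linear functionals are linear functionals of [e^M].
    Given the parameters, the noise relation is a pathwise identity, triangular
    in either noise sequence, so each path determines the other. *)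

(** * Second moments of square-integrable random vectors *)

Section SecondMoments.
Context (R : realType) (disp : measure_display) (T : measurableType disp).
Variable P : probability T R.

(** The L2 norm is a power of the integral of [f * f], which is the real number [r], hence
    finite. *)
Lemma Lfun2_of_sqr_expectation (f : T -> R) (r : R) :
  measurable_fun [set: T] f ->
  ('E_P[fun w => (f w * f w)%R] = r%:E)%E -> f \in Lfun P 2%:E.
Proof.
move=> mf; rewrite unlock => Ef.
rewrite inE; apply/andP; split; rewrite inE//=.
rewrite /finite_norm unlock poweR_lty//.
under eq_integral => w _ do
  rewrite /= powR_mulrn// -normrX expr2 ger0_norm -?expr2 ?sqr_ge0// expr2.
by rewrite Ef ltry.
Qed.

Lemma Lfun2_linear (f g : T -> R) (a : R) :
  f \in Lfun P 2%:E -> g \in Lfun P 2%:E ->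
  (fun w => a * f w + g w) \in Lfun P 2%:E.
Proof. exact: (@Lfun_submod_closed _ T R P _ (lee1n 2)).2. Qed.

Lemma Lfun2_sum (I : Type) (s : seq I) (a : I -> R) (f : I -> T -> R) :
  (forall i, f i \in Lfun P 2%:E) ->
  (fun w => \sum_(i <- s) a i * f i w) \in Lfun P 2%:E.
Proof.
move=> f2; elim: s => [|i s IH].
  by under eq_fun do rewrite big_nil; exact: (@Lfun_cst _ T R P).
by under eq_fun do rewrite big_cons; exact: Lfun2_linear.
Qed.

(** [fine] is additive only on finite values; products of two L2 functions are integrable, so every
    expectation met in the induction is finite. *)
Lemma expectation_sum_mul (I : Type) (s : seq I) (a : I -> R)
    (f : I -> T -> R) (g : T -> R) :
  (forall i, f i \in Lfun P 2%:E) -> g \in Lfun P 2%:E ->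
  fine 'E_P[fun w => ((\sum_(i <- s) a i * f i w) * g w)%R]%E =
  \sum_(i <- s) a i * fine 'E_P[fun w => (f i w * g w)%R]%E.
Proof.
move=> f2 g2; elim: s => [|i s IH].
  under eq_fun do rewrite big_nil mul0r.
  by rewrite big_nil expectation_cst.
under eq_fun do rewrite big_cons mulrDl -mulrA.
have L1 : (fun w => f i w * g w) \in Lfun P 1 by exact: Lfun2_mul_Lfun1.
have L1s : (fun w => (\sum_(j <- s) a j * f j w) * g w) \in Lfun P 1.
  by apply: Lfun2_mul_Lfun1 => //; exact: Lfun2_sum.
have L1a : (fun w => a i * (f i w * g w)) \in Lfun P 1.
  under eq_fun do rewrite mulrC.
  exact: Lfun_scale.
rewrite (expectationD L1a L1s) fineD ?expectation_fin_num// IH big_cons.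
congr (_ + _).
under eq_fun do rewrite mulrC.
by rewrite (expectationZl (a i) L1) fineM ?expectation_fin_num.
Qed.

Definition square_integrable n (X : T -> 'cV[R]_n) : Prop :=
  forall i, (fun w => X w i 0) \in Lfun P 2%:E.

(** The matrix E[X Y'], uncentred. [fine] gives real entries, which are the true moments once [X]
    and [Y] are square integrable. *)
Definition second_moment m n (X : T -> 'cV[R]_m) (Y : T -> 'cV[R]_n)
    : 'M[R]_(m, n) :=
  \matrix_(i, j) fine 'E_P[fun w => (X w i 0 * Y w j 0)%R]%E.

Lemma square_integrableD n (X Y : T -> 'cV[R]_n) :
  square_integrable X -> square_integrable Y ->
  square_integrable (fun w => X w + Y w).
Proof.
move=> X2 Y2 i; under eq_fun do rewrite mxE -[X in X + _]mul1r.
exact: Lfun2_linear.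
Qed.

Lemma square_integrable_mulmx m n (A : 'M[R]_(m, n)) (X : T -> 'cV[R]_n) :
  square_integrable X -> square_integrable (fun w => A *m X w).
Proof. by move=> X2 i; under eq_fun do rewrite mxE; exact: Lfun2_sum. Qed.

Lemma square_integrable_cst n (v : 'cV[R]_n) :
  square_integrable (fun=> v).
Proof. by move=> i; exact: Lfun_cst. Qed.

Lemma tr_second_moment m n (X : T -> 'cV[R]_m) (Y : T -> 'cV[R]_n) :
  (second_moment X Y)^T = second_moment Y X.
Proof.
apply/matrixP => i j; rewrite !mxE.
by under eq_fun do rewrite mulrC.
Qed.

Lemma second_moment_mulmxl m n p (A : 'M[R]_(m, n)) (X : T -> 'cV[R]_n)
    (Y : T -> 'cV[R]_p) :
  square_integrable X -> square_integrable Y ->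
  second_moment (fun w => A *m X w) Y = A *m second_moment X Y.
Proof.
move=> X2 Y2; apply/matrixP => i j; rewrite !mxE.
under eq_fun do rewrite mxE.
rewrite expectation_sum_mul//.
by apply: eq_bigr => k _; rewrite mxE.
Qed.

Lemma second_momentDl m n (X X' : T -> 'cV[R]_m) (Y : T -> 'cV[R]_n) :
  square_integrable X -> square_integrable X' -> square_integrable Y ->
  second_moment (fun w => X w + X' w) Y = second_moment X Y + second_moment X' Y.
Proof.
move=> X2 X'2 Y2; apply/matrixP => i j; rewrite !mxE.
under eq_fun do rewrite mxE mulrDl.
rewrite (expectationD (Lfun2_mul_Lfun1 (X2 i) (Y2 j)) (Lfun2_mul_Lfun1 (X'2 i) (Y2 j))).
by rewrite fineD// expectation_fin_num// Lfun2_mul_Lfun1.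
Qed.

Lemma second_moment_mulmxr m n p (A : 'M[R]_(m, n)) (X : T -> 'cV[R]_n)
    (Y : T -> 'cV[R]_p) :
  square_integrable X -> square_integrable Y ->
  second_moment Y (fun w => A *m X w) = second_moment Y X *m A^T.
Proof.
move=> X2 Y2.
by rewrite -tr_second_moment second_moment_mulmxl// trmx_mul tr_second_moment.
Qed.

Lemma second_momentDr m n (X X' : T -> 'cV[R]_m) (Y : T -> 'cV[R]_n) :
  square_integrable X -> square_integrable X' -> square_integrable Y ->
  second_moment Y (fun w => X w + X' w) = second_moment Y X + second_moment Y X'.
Proof.
move=> X2 X'2 Y2.
by rewrite -tr_second_moment second_momentDl// linearD /= !tr_second_moment.
Qed.

Lemma outer_product_expectation m n (X : T -> 'cV[R]_m) (Y : T -> 'cV[R]_n) i j :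
  square_integrable X -> square_integrable Y ->
  'E_P[fun w => ((X w *m (Y w)^T) i j)%R]%E = (second_moment X Y i j)%:E.
Proof.
move=> X2 Y2; rewrite mxE.
under eq_fun do rewrite mxE big_ord1 mxE.
by rewrite fineK// expectation_fin_num// Lfun2_mul_Lfun1.
Qed.

(** Writing the mean as a second moment against the constant 1 lets the bilinearity lemmas handle
    zero means too. *)
Lemma component_expectation m (X : T -> 'cV[R]_m) i :
  square_integrable X ->
  'E_P[fun w => (X w i 0)%R]%E =
  (second_moment X (fun=> const_mx 1 : 'cV_1) i 0)%:E.
Proof.
move=> X2; rewrite mxE.
have -> : (fun w => X w i 0) = (fun w => X w i 0 * (const_mx 1 : 'cV[R]_1) 0 0).
  by apply/funext => w; rewrite mxE mulr1.
by rewrite fineK// expectation_fin_num// Lfun2_mul_Lfun1// square_integrable_cst.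
Qed.

End SecondMoments.

(** * Positive definite matrices *)

Section PositiveDefinite.
Context (R : realType).

(** A nonzero vector in the left kernel would make the quadratic form vanish. *)
Lemma posdefmx_unit d (Q : 'M[R]_d) : posdefmx Q -> Q \in unitmx.
Proof.
move=> [QT Qpos]; rewrite -row_free_unit -kermx_eq0; apply/rowV0P => u.
move=> /sub_kermxP uQ; apply/eqP/negP => /negP u0.
by have := Qpos u^T; rewrite trmxK uQ mul0mx mxE ltxx trmx_eq0 => /(_ u0).
Qed.

(** With [w = Q^-1 v], the form [v' Q^-1 v] equals [w' Q w]. *)
Lemma posdefmx_inv d (Q : 'M[R]_d) : posdefmx Q -> posdefmx (invmx Q).
Proof.
move=> Qp; have Qu := posdefmx_unit Qp; have [QT Qpos] := Qp.
split=> [|v v0]; first by rewrite trmx_inv QT.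
have w0 : invmx Q *m v != 0.
  by apply: contra v0 => /eqP w0; rewrite -[v](mulKVmx Qu) w0 mulmx0.
by have := Qpos _ w0; rewrite trmx_mul trmx_inv QT -!mulmxA mulKVmx.
Qed.

(** [A] may be singular, so the second term is only nonnegative; strictness comes from [Q]. *)
Lemma posdefmxD_congr m d (Q : 'M[R]_d) (S : 'M[R]_m) (A : 'M[R]_(m, d)) :
  posdefmx Q -> posdefmx S -> posdefmx (Q + A^T *m S *m A).
Proof.
move=> [QT Qpos] [ST Spos]; split=> [|v v0].
  by rewrite linearD /= QT !trmx_mul trmxK ST mulmxA.
rewrite mulmxDr mulmxDl mxE ltr_pwDl ?Qpos//.
rewrite !mulmxA -trmx_mul -(mulmxA _ A).
have [->|Av0] := eqVneq (A *m v) 0; first by rewrite mulmx0 mxE.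
exact/ltW/Spos.
Qed.

End PositiveDefinite.

(** * Matrix algebra of one backward regression step *)

Section BackwardStep.
Context (R : realType) (d : nat).
Implicit Types F M C G B : 'M[R]_d.

(* If [u] has covariance [C] and [v = F u + e], with [e] uncorrelated with [u]
   and of covariance [M], these are the covariance of [v], the error covariance
   of the linear regression of [u] on [v] (Woodbury form) and its gain. *)
Definition next_cov F M C := F *m C *m F^T + M.
Definition smoothing_cov F M C := invmx (invmx C + F^T *m invmx M *m F).
Definition smoothing_gain F M C := smoothing_cov F M C *m F^T *m invmx M.

Context (F M C : 'M[R]_d) (hM : posdefmx M) (hC : posdefmx C).

Lemma posdefmx_next_cov : posdefmx (next_cov F M C).
Proof.
by rewrite /next_cov addrC -{1}(trmxK F); exact: posdefmxD_congr.
Qed.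

Lemma posdefmx_smoothing_cov : posdefmx (smoothing_cov F M C).
Proof.
by apply/posdefmx_inv/posdefmxD_congr; exact: posdefmx_inv.
Qed.

Lemma invmx_smoothing_cov :
  invmx (smoothing_cov F M C) = invmx C + F^T *m invmx M *m F.
Proof. exact: invmxK. Qed.

(** The normal equation of the regression. Multiplied on the left by the inverse smoothing
    covariance, it reads [F' M^-1 (F C F' + M) = (C^-1 + F' M^-1 F) C F']. *)
Lemma smoothing_gain_next_cov :
  smoothing_gain F M C *m next_cov F M C = C *m F^T.
Proof.
have Bu := posdefmx_unit posdefmx_smoothing_cov.
have Mu := posdefmx_unit hM; have Cu := posdefmx_unit hC.
rewrite -[RHS](mulKVmx Bu) invmx_smoothing_cov /smoothing_gain /next_cov.
rewrite -!mulmxA; congr (_ *m _).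
by rewrite !(mulmxDl, mulmxDr) mulVmx// mulmx1 mulKmx// !mulmxA addrC.
Qed.

(** Multiplied on the left by the inverse smoothing covariance, both sides become
    [1 + F' M^-1 F C]. *)
Lemma smoothing_cov_decomposition :
  smoothing_gain F M C *m F *m C + smoothing_cov F M C = C.
Proof.
have Bu := posdefmx_unit posdefmx_smoothing_cov.
have Cu := posdefmx_unit hC.
rewrite -[RHS](mulKVmx Bu) invmx_smoothing_cov /smoothing_gain.
by rewrite mulmxDl mulVmx// mulmxDr mulmx1 addrC !mulmxA.
Qed.

Lemma tr_smoothing_gain_inv_cov :
  (smoothing_gain F M C)^T *m invmx (smoothing_cov F M C) = invmx M *m F.
Proof.
have Bu := posdefmx_unit posdefmx_smoothing_cov.
rewrite !trmx_mul trmx_inv trmxK hM.1 posdefmx_smoothing_cov.1.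
by rewrite mulmxA mulmxK.
Qed.

Lemma inv_smoothing_cov_gain :
  invmx (smoothing_cov F M C) *m smoothing_gain F M C = F^T *m invmx M.
Proof.
have Bu := posdefmx_unit posdefmx_smoothing_cov.
by rewrite /smoothing_gain -mulmxA mulKmx.
Qed.

(** Write [D] for [next_cov F M C] and [G] for the gain. The right side is [M^-1 - M^-1 F G]; as
    [G D = C F'], its product with [D] is [M^-1 (D - F C F') = 1]. *)
Lemma invmx_next_cov :
  invmx (next_cov F M C) =
  invmx M - (smoothing_gain F M C)^T *m invmx (smoothing_cov F M C)
            *m smoothing_gain F M C.
Proof.
have Mu := posdefmx_unit hM; have Du := posdefmx_unit posdefmx_next_cov.
rewrite tr_smoothing_gain_inv_cov -[RHS](mulmxK Du).
rewrite mulmxBl -(mulmxA (_ *m F)) smoothing_gain_next_cov /next_cov.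
by rewrite mulmxDr mulVmx// !mulmxA addrAC subrr add0r mul1mx.
Qed.

(** Invertibility of the next covariance determines [G] from the first equation; the second then
    gives [B]. *)
Lemma smoothing_gain_unique G B :
  G *m next_cov F M C = C *m F^T -> G *m F *m C + B = C ->
  G = smoothing_gain F M C /\ B = smoothing_cov F M C.
Proof.
move=> GD GFC; have Du := posdefmx_unit posdefmx_next_cov.
have GE : G = smoothing_gain F M C.
  by rewrite -[G](mulmxK Du) GD -smoothing_gain_next_cov mulmxK.
split=> //; apply: (addrI (G *m F *m C)).
by rewrite GFC GE smoothing_cov_decomposition.
Qed.

End BackwardStep.

(** * Parameter recursion and pathwise relation between the two noises *)

Section SamplePaths.
Context (R : realType) (d N : nat).
Implicit Types (M F MB FB : nat -> 'M[R]_d) (e eB x : nat -> 'cV[R]_d).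

Fixpoint state_cov M F (k : nat) : 'M[R]_d :=
  if k is k'.+1 then next_cov (F k) (M k) (state_cov M F k') else M 0%N.

(** Closed form of the backward parameters through the state covariances, which
    [backward_parameters] avoids. At [N] the noise is [x_N] itself, whence the last clause. *)
Definition smoothing_parameters M F MB FB : Prop :=
  (forall k, (k < N)%N ->
     FB k = smoothing_gain (F k.+1) (M k.+1) (state_cov M F k) /\
     MB k = smoothing_cov (F k.+1) (M k.+1) (state_cov M F k)) /\
  MB N = state_cov M F N.

Section SmoothingModel.
Context (M F MB FB : nat -> 'M[R]_d).
Hypothesis hN : (1 <= N)%N.
Hypothesis hM : forall k, (k <= N)%N -> posdefmx (M k).
Hypothesis hB : smoothing_parameters M F MB FB.

Lemma posdefmx_state_cov k : (k <= N)%N -> posdefmx (state_cov M F k).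
Proof.
elim: k => [|k IH] kN; first exact: hM.
by apply: posdefmx_next_cov; [exact: hM|exact/IH/ltnW].
Qed.

Lemma smoothing_parameters_posdefmx k : (k <= N)%N -> posdefmx (MB k).
Proof.
rewrite leq_eqVlt => /predU1P[->|kN]; first by rewrite hB.2; exact: posdefmx_state_cov.
rewrite (hB.1 k kN).2; apply: posdefmx_smoothing_cov; first exact: hM.
exact/posdefmx_state_cov/ltnW.
Qed.

Lemma invmx_state_covS k : (k < N)%N ->
  invmx (state_cov M F k.+1) =
  invmx (M k.+1) - (FB k)^T *m invmx (MB k) *m FB k.
Proof.
move=> kN; rewrite (hB.1 k kN).1 (hB.1 k kN).2 /= invmx_next_cov//; first exact: hM.
exact/posdefmx_state_cov/ltnW.
Qed.

(** In [MB_k^-1 = C_k^-1 + F' M^-1 F], the inverse state covariance is eliminated by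
    [invmx_state_covS], or is [M_0^-1] when [k = 0]. *)
Lemma smoothing_parameters_backward : backward_parameters N M F MB FB.
Proof.
split.
- by rewrite (hB.1 0%N hN).2 invmx_smoothing_cov.
- by rewrite (hB.1 0%N hN).1 (hB.1 0%N hN).2.
- case=> [//|[//|k]] /= kN.
  by rewrite (hB.1 k.+1 kN).2 invmx_smoothing_cov invmx_state_covS 1?ltnW// addrAC.
- by case=> [//|[//|k]] /= kN; rewrite (hB.1 k.+1 kN).1 (hB.1 k.+1 kN).2.
- by rewrite hB.2; case: N hN invmx_state_covS => // n _; exact.
Qed.

(* With [C_k] the covariance of [x_k], both sides of the relation at [k] equal
   [C_k^-1 x_k - F_(k+1)' M_(k+1)^-1 e_(k+1)]. *)
Lemma smoothing_noise_relation e eB x :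
  forward_governs N F e x -> backward_governs N FB eB x ->
  noise_relation N M F MB FB e eB.
Proof.
move=> [x0 xS] [xN xB].
have eE k : (k < N)%N -> e k.+1 = x k.+1 - F k.+1 *m x k.
  by move=> kN; rewrite (xS k.+1)//= addrC addKr.
have eBE k : (k < N)%N -> eB k = x k - FB k *m x k.+1.
  by move=> kN; rewrite [in RHS](xB k)// addrC addKr.
have lhs k : (k < N)%N -> invmx (MB k) *m eB k =
    invmx (state_cov M F k) *m x k - (F k.+1)^T *m invmx (M k.+1) *m e k.+1.
  move=> kN; rewrite eBE// eE// !mulmxBr.
  have Ck := posdefmx_state_cov (ltnW kN).
  rewrite (mulmxA _ (FB k)) (hB.1 k kN).1 (hB.1 k kN).2.
  rewrite inv_smoothing_cov_gain//; last exact: hM.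
  by rewrite invmx_smoothing_cov mulmxDl opprB addrA !mulmxA.
have rhs k : (k < N)%N ->
    (FB k)^T *m invmx (MB k) *m eB k + invmx (M k.+1) *m e k.+1 =
    invmx (state_cov M F k.+1) *m x k.+1.
  move=> kN; rewrite invmx_state_covS// mulmxBl eBE// eE// !mulmxBr.
  rewrite !mulmxA; have Ck := posdefmx_state_cov (ltnW kN).
  have -> : (FB k)^T *m invmx (MB k) = invmx (M k.+1) *m F k.+1.
    by rewrite (hB.1 k kN).1 (hB.1 k kN).2 tr_smoothing_gain_inv_cov//; exact: hM.
  by rewrite addrC addrA subrK.
split.
- by rewrite lhs// x0.
- by case=> [//|k] /= kN; rewrite lhs// rhs// ltnW.
- rewrite hB.2 -xN; case: N hN rhs => // n _ /(_ n (leqnn _)) /= ->//.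
Qed.

End SmoothingModel.

(** For given [e], the first relation fixes [eB 0] and each later one fixes [eB k] from
    [eB k.-1]. *)
Lemma noise_relation_inj_backward M F MB FB e eB eB' :
  (1 <= N)%N -> (forall k, (k <= N)%N -> MB k \in unitmx) ->
  noise_relation N M F MB FB e eB -> noise_relation N M F MB FB e eB' ->
  forall k, (k <= N)%N -> eB k = eB' k.
Proof.
move=> hN MBu [r0 rk rN] [r0' rk' rN'].
have cancel k : (k <= N)%N -> invmx (MB k) *m eB k = invmx (MB k) *m eB' k ->
    eB k = eB' k.
  by move=> kN eq_k; rewrite -[eB k](mulKVmx (MBu k kN)) eq_k mulKVmx// MBu.
elim=> [|k IH] kN; first by apply: cancel => //; rewrite r0 r0'.
apply: cancel => //; move: (kN); rewrite leq_eqVlt => /predU1P[kE|kN'].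
  by move: rN rN'; rewrite -kE /= => -> ->; rewrite IH// ltnW.
by rewrite rk// rk'//= IH// ltnW.
Qed.

(** For given [eB], the system is solved downwards: the last relation fixes [e N], and each earlier
    one fixes [e k] from [e k.+1]. *)
Lemma noise_relation_inj_forward M F MB FB e e' eB :
  (1 <= N)%N -> (forall k, (k <= N)%N -> M k \in unitmx) ->
  noise_relation N M F MB FB e eB -> noise_relation N M F MB FB e' eB ->
  forall k, (k <= N)%N -> e k = e' k.
Proof.
move=> hN Mu [r0 rk rN] [r0' rk' rN'].
have cancel k : (k <= N)%N -> invmx (M k) *m e k = invmx (M k) *m e' k ->
    e k = e' k.
  by move=> kN eq_k; rewrite -[e k](mulKVmx (Mu k kN)) eq_k mulKVmx// Mu.
(* Descending induction on [k], run as induction on [j = N - k]. *)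
suff H j k : (k + j)%N = N -> e k = e' k.
  by move=> k kN; apply: (H (N - k)%N); rewrite subnKC.
elim: j k => [|j IH] k kjN.
  rewrite addn0 in kjN; rewrite kjN; apply: cancel => //.
  by move: rN; rewrite rN' => /addrI.
have eS : e k.+1 = e' k.+1 by apply: IH; rewrite addSnnS.
have kN : (k < N)%N by rewrite -kjN -addSnnS leq_addr.
apply: cancel; first exact: ltnW.
case: k eS kN {kjN} => [|k] eS kN.
  by move: r0; rewrite r0' eS => /addIr.
by have := rk k.+1 kN; rewrite rk'// eS => /addIr/addrI.
Qed.

(** The residuals of [x] in the other model are the only noise that can generate [x]. They satisfy
    the noise relation, which determines them by triangularity. *)
Lemma smoothing_sample_equivalent M F MB FB :
  (1 <= N)%N -> (forall k, (k <= N)%N -> posdefmx (M k)) ->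
  smoothing_parameters M F MB FB ->
  explicitly_sample_equivalent N (forward_governs N F) (backward_governs N FB)
    (noise_relation N M F MB FB).
Proof.
move=> hN hM hB; split=> x.
  move=> e ex; pose eB k := if (k < N)%N then x k - FB k *m x k.+1 else x k.
  have eBx : backward_governs N FB eB x.
    split=> [|k kN]; first by rewrite /eB ltnn.
    by rewrite /eB kN addrC subrK.
  have rel := smoothing_noise_relation hN hM hB ex eBx.
  exists eB; split=> // eB' rel'; apply: noise_relation_inj_backward rel' rel => //.
  by move=> k kN; apply: posdefmx_unit (smoothing_parameters_posdefmx hM hB kN).
move=> eB eBx; pose e k := if k is k'.+1 then x k - F k *m x k' else x 0%N.
have ex : forward_governs N F e x.
  by split=> // -[//|k] kN /=; rewrite addrC subrK.
have rel := smoothing_noise_relation hN hM hB ex eBx.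
exists e; split=> // e' rel'; apply: noise_relation_inj_forward rel' rel => //.
by move=> k kN; exact: posdefmx_unit (hM k kN).
Qed.

End SamplePaths.

(** * Linear functionals of a Gaussian sequence *)

Section LinearSpan.
Context (R : realType) (d : nat) (disp : measure_display) (T : measurableType disp).
Variables (N : nat) (e : nat -> T -> 'cV[R]_d).

(** Same shape as the combinations in [gaussian_sequence], so that joint Gaussianity applies to it
    directly. *)
Definition linear_functional_of (f : T -> R) : Prop :=
  exists c : nat -> 'cV[R]_d,
    forall w, f w = \sum_(k < N.+1) ((c k)^T *m e k w) 0 0.

Lemma linear_functionalD f g : linear_functional_of f -> linear_functional_of g ->
  linear_functional_of (fun w => f w + g w).
Proof.
move=> [a fa] [b gb]; exists (fun k => a k + b k) => w.
rewrite fa gb -big_split; apply: eq_bigr => k _ /=.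
by rewrite linearD mulmxDl [RHS]mxE.
Qed.

Lemma linear_functional_sum n (f : nat -> T -> R) :
  (forall k, (k < n)%N -> linear_functional_of (f k)) ->
  linear_functional_of (fun w => \sum_(k < n) f k w).
Proof.
elim: n => [|n IH] fn.
  exists (fun=> 0) => w; rewrite big_ord0 big1// => k _.
  by rewrite trmx0 mul0mx mxE.
under eq_fun do rewrite big_ord_recr.
apply: linear_functionalD; last exact: fn.
by apply: IH => k kn; apply/fn/ltnW.
Qed.

Lemma linear_functional_component (v : 'cV[R]_d) k : (k <= N)%N ->
  linear_functional_of (fun w => (v^T *m e k w) 0 0).
Proof.
move=> kN; exists (fun j => if j == k then v else 0) => w.
rewrite (bigD1 (Ordinal (kN : (k < N.+1)%N)))//= eqxx big1 ?addr0// => j.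
by rewrite -val_eqE /= => /negbTE ->; rewrite trmx0 mul0mx mxE.
Qed.

Lemma gaussian_sequence_linear (P : probability T R) (y : nat -> T -> 'cV[R]_d) :
  gaussian_sequence P N e ->
  (forall k, (k <= N)%N -> forall i, measurable_fun [set: T] (fun w => y k w i 0)) ->
  (forall k, (k <= N)%N -> forall v : 'cV[R]_d,
     linear_functional_of (fun w => (v^T *m y k w) 0 0)) ->
  gaussian_sequence P N y.
Proof.
move=> [_ eG] my ye; split=> // c.
have [c' cE] := linear_functional_sum (fun k (kN : (k < N.+1)%N) => ye k kN (c k)).
by rewrite (funext cE); exact: eG.
Qed.

End LinearSpan.

(** * White sequences in terms of second moments *)

Section WhiteSequences.
Context (R : realType) (d : nat) (disp : measure_display) (T : measurableType disp).
Context (P : probability T R) (N : nat).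
Implicit Types (e : nat -> T -> 'cV[R]_d) (Q : nat -> 'M[R]_d).

(** The diagonal entries of [Q k] are the second moments of the components, and they are finite. *)
Lemma white_square_integrable e Q : zero_mean_white_nonsingular_gaussian P N e Q ->
  forall k, (k <= N)%N -> square_integrable P (e k).
Proof.
move=> [[me _] _ _ eQ _] k kN i.
apply: (@Lfun2_of_sqr_expectation _ _ _ _ _ (Q k i i)); first exact: me.
by rewrite -eQ//; congr expectation; apply/funext => w; rewrite mxE big_ord1 mxE.
Qed.

Lemma square_integrable_measurable n (X : T -> 'cV[R]_n) : square_integrable P X ->
  forall i, measurable_fun [set: T] (fun w => X w i 0).
Proof. by move=> X2 i; move: (X2 i); rewrite inE => /andP[/set_mem]. Qed.

(* Zero mean is orthogonality to the constant [1]. *)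
Lemma white_second_moments e Q :
  (forall k, (k <= N)%N -> square_integrable P (e k)) ->
  zero_mean_white_nonsingular_gaussian P N e Q <->
  [/\ gaussian_sequence P N e,
      forall k, (k <= N)%N ->
        second_moment P (e k) (fun=> const_mx 1 : 'cV_1) = 0,
      forall k j, (k < j)%N -> (j <= N)%N -> second_moment P (e k) (e j) = 0,
      forall k, (k <= N)%N -> second_moment P (e k) (e k) = Q k
    & forall k, (k <= N)%N -> posdefmx (Q k)].
Proof.
move=> e2; split=> -[eG e0 ej ek Qp]; split=> //.
- move=> k kN; apply/matrixP => i j; rewrite (ord1 j) [RHS]mxE.
  by apply: EFin_inj; rewrite -component_expectation ?e0//; exact: e2.
- move=> k j kj jN; have kN := leq_trans (ltnW kj) jN.
  apply/matrixP => i l; rewrite [RHS]mxE; apply: EFin_inj.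
  by rewrite -outer_product_expectation ?ej ?ltn_eqF//; exact: e2.
- move=> k kN; apply/matrixP => i l; apply: EFin_inj.
  by rewrite -outer_product_expectation ?ek//; exact: e2.
- by move=> k kN i; rewrite component_expectation ?e0 ?mxE//; exact: e2.
- move=> k j kN jN kj i l; rewrite outer_product_expectation; try exact: e2.
  have [/ej->//|jk|/eqP] := ltngtP k j; [by rewrite mxE| |by rewrite (negbTE kj)].
  by rewrite -tr_second_moment ej// !mxE.
- by move=> k kN i l; rewrite outer_product_expectation ?ek//; exact: e2.
Qed.

End WhiteSequences.

(** * Covariances of the forward model and uniqueness of the backward parameters *)

Section ForwardModel.
Context (R : realType) (d N : nat) (disp : measure_display) (T : measurableType disp).
Context (P : probability T R) (M F : nat -> 'M[R]_d) (eM x : nat -> T -> 'cV[R]_d).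
Hypothesis hN : (1 <= N)%N.
Hypothesis hfwd : forward_markov_model P N M F eM x.

Local Notation S := (second_moment P).
Local Notation one := (fun=> const_mx 1 : 'cV_1).

Let eM2 : forall k, (k <= N)%N -> square_integrable P (eM k).
Proof. by case: hfwd => /white_square_integrable. Qed.

Let xS k : (k < N)%N -> x k.+1 = fun w => F k.+1 *m x k w + eM k.+1 w.
Proof. by move=> kN; apply/funext => w; exact: (hfwd.2 w).2. Qed.

Let x0 : x 0%N = eM 0%N.
Proof. by apply/funext => w; exact: (hfwd.2 w).1. Qed.

Lemma forward_square_integrable k : (k <= N)%N -> square_integrable P (x k).
Proof.
elim: k => [|k IH] kN; first by rewrite x0; exact: eM2.
rewrite xS//; apply: square_integrableD; last exact: eM2.
exact/square_integrable_mulmx/IH/ltnW.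
Qed.
Let x2 := forward_square_integrable.

Let hM : forall k, (k <= N)%N -> posdefmx (M k).
Proof. by case: hfwd => -[]. Qed.

Let eM_moments := (white_second_moments M eM2).1 hfwd.1.

(** The state [x_k] is built from [e_0, ..., e_k] only, all uncorrelated with a later noise. *)
Lemma forward_noise_state k j : (k < j)%N -> (j <= N)%N -> S (x k) (eM j) = 0.
Proof.
case: eM_moments => _ _ eMj _ _; elim: k => [|k IH] kj jN; first by rewrite x0 eMj.
have kN : (k < N)%N by exact: leq_trans (ltnW kj) jN.
rewrite xS// second_momentDl; try exact: eM2.
  rewrite second_moment_mulmxl; [|exact/x2/ltnW|exact: eM2].
  by rewrite (IH (ltnW kj) jN) mulmx0 add0r eMj.
exact/square_integrable_mulmx/x2/ltnW.
Qed.

Lemma forward_state_mean k : (k <= N)%N -> S (x k) one = 0.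
Proof.
case: eM_moments => _ eM0 _ _ _; elim: k => [|k IH] kN; first by rewrite x0 eM0.
have c2 := square_integrable_cst P (const_mx 1 : 'cV[R]_1).
have xk2 := x2 (ltnW kN).
rewrite xS// second_momentDl//; [|exact: square_integrable_mulmx|exact: eM2].
by rewrite second_moment_mulmxl// IH 1?ltnW// mulmx0 add0r eM0.
Qed.

Lemma forward_cov_step k (Y : T -> 'cV[R]_d) : (k < N)%N -> square_integrable P Y ->
  S Y (eM k.+1) = 0 -> S Y (x k.+1) = S Y (x k) *m (F k.+1)^T.
Proof.
move=> kN Y2 Ye; have xk2 := x2 (ltnW kN).
rewrite xS// second_momentDr//; [|exact: square_integrable_mulmx|exact: eM2].
by rewrite second_moment_mulmxr// Ye addr0.
Qed.

(** The cross terms of [x_(k+1) = F x_k + e_(k+1)] vanish, leaving the recursion that defines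
    [state_cov]. *)
Lemma forward_state_cov k : (k <= N)%N -> S (x k) (x k) = state_cov M F k.
Proof.
case: eM_moments => _ _ eMj eMk _; elim: k => [|k IH] kN; first by rewrite x0 eMk.
have xk2 := x2 (ltnW kN); have ek2 := eM2 kN; have xS2 := x2 kN.
have xe : S (x k) (eM k.+1) = 0 by exact: forward_noise_state.
have xSx : S (x k.+1) (x k) = F k.+1 *m state_cov M F k.
  rewrite -tr_second_moment forward_cov_step// IH 1?ltnW//.
  by rewrite trmx_mul trmxK (posdefmx_state_cov F hM (ltnW kN)).1.
rewrite {2}xS// second_momentDr//; last exact: square_integrable_mulmx.
rewrite second_moment_mulmxr// xSx; congr (_ + _).
rewrite xS// second_momentDl//; last exact: square_integrable_mulmx.
by rewrite second_moment_mulmxl// xe mulmx0 add0r eMk.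
Qed.

Lemma forward_consecutive_cov k : (k < N)%N ->
  S (x k) (x k.+1) = state_cov M F k *m (F k.+1)^T.
Proof.
move=> kN; have xk2 := x2 (ltnW kN); have xe := forward_noise_state (ltnSn k) kN.
by rewrite forward_cov_step// forward_state_cov// ltnW.
Qed.

(** Whiteness makes [eMB k] orthogonal to all later states, so the backward equation is a regression
    of [x_k] on [x_(k+1)], whose coefficients are unique. *)
Lemma backward_model_parameters MB FB eMB :
  backward_markov_model P N MB FB eMB x -> smoothing_parameters N M F MB FB.
Proof.
move=> [hB hxB].
have eB2 := white_square_integrable hB.
have [_ _ eBj eBk _] := (white_second_moments MB eB2).1 hB.
have xB k : (k < N)%N -> x k = fun w => FB k *m x k.+1 w + eMB k w.
  by move=> kN; apply/funext => w; exact: (hxB w).2.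
have xN : x N = eMB N by apply/funext => w; exact: (hxB w).1.
(* Induction on the distance [j] from the end: [x_N] is [eMB N], and each earlier state combines the
   next one with a noise of index greater than [k]. *)
have eBx j k : (k + j < N)%N -> S (eMB k) (x (N - j)%N) = 0.
  elim: j k => [|j IH] k kj; first by rewrite subn0 xN eBj// -(addn0 k).
  have jN : (j < N)%N by rewrite (leq_trans _ kj)// ltnS -addSnnS ltnW// ltnS leq_addl.
  have kN : (k <= N)%N by rewrite (leq_trans _ (ltnW kj))// leq_addr.
  have NjN : (N - j.+1 < N)%N by rewrite ltn_subrL hN.
  have NjS : (N - j.+1).+1 = (N - j)%N by rewrite subnSK.
  have kNj : (k < N - j.+1)%N by rewrite ltn_subRL addnC.
  have xj2 : square_integrable P (x (N - j)%N) by apply: x2; exact: leq_subr.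
  have eBk2 := eB2 _ kN; have eBj2 := eB2 _ (leq_subr j.+1 N).
  rewrite xB// NjS second_momentDr//; last exact: square_integrable_mulmx.
  rewrite second_moment_mulmxr//.
  by rewrite eBj ?leq_subr// IH ?mul0mx ?addr0// (leq_trans _ kj)// ltnS addnS leqnSn.
have eBxj k j : (k < j)%N -> (j <= N)%N -> S (eMB k) (x j) = 0.
  move=> kj jN; rewrite -(subKn jN) eBx//.
  by rewrite addnC -ltn_subRL subKn.
split; last by rewrite -forward_state_cov// xN eBk.
move=> k kN; have xS2 := x2 kN; have eBk2 := eB2 _ (ltnW kN).
have Gx2 := square_integrable_mulmx (FB k) xS2; have xk2 := x2 (ltnW kN).
have Cp := posdefmx_state_cov F hM (ltnW kN).
have eBxk : S (eMB k) (x k) = MB k.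
  rewrite xB// second_momentDr// second_moment_mulmxr// eBxj// mul0mx add0r.
  by rewrite eBk// ltnW.
(* Both equations come from expanding the left factor by the backward model, in E[x_k x_(k+1)'] and
   then in E[x_k x_k']. *)
apply: smoothing_gain_unique => //; first exact: hM.
  rewrite -forward_consecutive_cov// [in RHS]xB// second_momentDl//.
  by rewrite second_moment_mulmxl// eBxj// addr0 forward_state_cov.
rewrite -[RHS]forward_state_cov 1?ltnW// {1}xB// second_momentDl// eBxk.
rewrite second_moment_mulmxl// -[S (x k.+1) _]tr_second_moment forward_consecutive_cov//.
by rewrite trmx_mul trmxK Cp.1 mulmxA.
Qed.

(** * Construction of a backward model by regression on the next state *)

Definition smoothing_trans k := smoothing_gain (F k.+1) (M k.+1) (state_cov M F k).
Definition smoothing_noise_cov k :=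
  if (k < N)%N then smoothing_cov (F k.+1) (M k.+1) (state_cov M F k)
  else state_cov M F N.
(** The regression residual, written as a sum with a negated matrix so that the additivity and
    [mulmx] lemmas apply as they stand. *)
Definition smoothing_noise k w :=
  if (k < N)%N then x k w + - smoothing_trans k *m x k.+1 w else x N w.

Let hsm : smoothing_parameters N M F smoothing_noise_cov smoothing_trans.
Proof. by rewrite /smoothing_noise_cov; split=> [k kN|]; rewrite ?kN ?ltnn. Qed.

Lemma smoothing_noiseE k : (k < N)%N ->
  smoothing_noise k = fun w => x k w + - smoothing_trans k *m x k.+1 w.
Proof. by move=> kN; apply/funext => w; rewrite /smoothing_noise kN. Qed.

Lemma smoothing_noiseN : smoothing_noise N = x N.
Proof. by apply/funext => w; rewrite /smoothing_noise ltnn. Qed.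

Lemma smoothing_noise_square_integrable k : (k <= N)%N ->
  square_integrable P (smoothing_noise k).
Proof.
rewrite leq_eqVlt => /predU1P[->|kN]; first by rewrite smoothing_noiseN; exact: x2.
rewrite smoothing_noiseE//; apply: square_integrableD; first exact/x2/ltnW.
exact/square_integrable_mulmx/x2.
Qed.
Let sn2 := smoothing_noise_square_integrable.

Lemma second_moment_smoothing_noise n k (Y : T -> 'cV[R]_n) : (k < N)%N ->
  square_integrable P Y ->
  S (smoothing_noise k) Y = S (x k) Y - smoothing_trans k *m S (x k.+1) Y.
Proof.
move=> kN Y2; have xS2 := x2 kN; have xk2 := x2 (ltnW kN).
rewrite smoothing_noiseE// second_momentDl//; last exact: square_integrable_mulmx.
by rewrite second_moment_mulmxl// mulNmx.
Qed.

(** For [j = k + 1] this is the normal equation. Beyond that, the new forward noise is uncorrelated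
    with [x_k] and [x_(k+1)], so orthogonality propagates through the transition. *)
Lemma smoothing_noise_future k j : (k < j)%N -> (j <= N)%N ->
  S (smoothing_noise k) (x j) = 0.
Proof.
elim: j => [//|j IH] kj jN.
have kN : (k < N)%N by exact: leq_trans kj jN.
have Cp := posdefmx_state_cov F hM (ltnW kN).
move: (kj); rewrite ltnS leq_eqVlt => /predU1P[kE|kj'].
  rewrite -kE second_moment_smoothing_noise//; last exact: x2.
  rewrite forward_consecutive_cov// forward_state_cov//=.
  by rewrite smoothing_gain_next_cov ?subrr//; exact: hM.
rewrite forward_cov_step ?IH ?mul0mx//; [exact: ltnW|exact/sn2/ltnW|].
rewrite second_moment_smoothing_noise//; last exact: eM2.
by rewrite !forward_noise_state// mulmx0 subr0.
Qed.

Lemma forward_state_functional k (v : 'cV[R]_d) : (k <= N)%N ->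
  linear_functional_of N eM (fun w => (v^T *m x k w) 0 0).
Proof.
elim: k v => [|k IH] v kN; first by rewrite x0; exact: linear_functional_component.
(* The row [v' F] is put in the form [(F' v)'], so that the induction hypothesis applies with
   another [v]. *)
rewrite xS//; under eq_fun do rewrite mulmxDr mxE mulmxA -[v^T *m _]trmxK.
apply: linear_functionalD; [exact/IH/ltnW|exact: linear_functional_component].
Qed.

Lemma smoothing_backward_model :
  backward_markov_model P N smoothing_noise_cov smoothing_trans smoothing_noise x.
Proof.
split; last first.
  move=> w; split=> [|k kN]; first by rewrite smoothing_noiseN.
  by rewrite smoothing_noiseE// mulNmx addrC subrK.
apply/(white_second_moments _ sn2); split.
- have [eG _ _ _ _] := eM_moments; apply: (gaussian_sequence_linear eG).
    by move=> k kN; exact: square_integrable_measurable (sn2 kN).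
  move=> k; rewrite leq_eqVlt => /predU1P[->|kN] v.
    by rewrite smoothing_noiseN; exact: forward_state_functional.
  rewrite smoothing_noiseE//.
  under eq_fun do rewrite mulmxDr mxE mulmxA -[v^T *m - _]trmxK.
  apply: linear_functionalD; apply: forward_state_functional => //.
  exact: ltnW.
- move=> k; rewrite leq_eqVlt => /predU1P[->|kN].
    by rewrite smoothing_noiseN forward_state_mean.
  rewrite second_moment_smoothing_noise//; last exact: square_integrable_cst.
  by rewrite !forward_state_mean ?mulmx0 ?subrr// ltnW.
(* For [j < N] the noise at [j] combines [x_j] and [x_(j+1)], both later than [k]; for [j = N] it is
   [x_N]. *)
- move=> k j kj jN; have k2 := sn2 (leq_trans (ltnW kj) jN).
  move: (jN); rewrite leq_eqVlt => /predU1P[jE|jN'].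
    by rewrite jE smoothing_noiseN smoothing_noise_future// -jE.
  rewrite -tr_second_moment second_moment_smoothing_noise//.
  rewrite -[S (x j) _]tr_second_moment -[S (x j.+1) _]tr_second_moment.
  rewrite (smoothing_noise_future kj jN) (smoothing_noise_future (leqW kj) jN').
  by rewrite !trmx0 mulmx0 subrr trmx0.
- move=> k; rewrite leq_eqVlt => /predU1P[->|kN].
    by rewrite smoothing_noiseN forward_state_cov// /smoothing_noise_cov ltnn.
  have Cp := posdefmx_state_cov F hM (ltnW kN); have xS2 := x2 kN.
  have xk2 := x2 (ltnW kN); have k2 := sn2 (ltnW kN).
  (* The residual is orthogonal to [x_(k+1)], so one factor may be replaced by [x_k]. *)
  have -> : S (smoothing_noise k) (smoothing_noise k) = S (smoothing_noise k) (x k).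
    rewrite {2}smoothing_noiseE// second_momentDr//; last exact: square_integrable_mulmx.
    by rewrite second_moment_mulmxr// (smoothing_noise_future (ltnSn k) kN) mul0mx addr0.
  rewrite second_moment_smoothing_noise// forward_state_cov 1?ltnW//.
  rewrite -[S (x k.+1) _]tr_second_moment forward_consecutive_cov//.
  (* What remains is [C - G F C]; splitting the first [C] as [G F C + B] leaves [B]. *)
  rewrite trmx_mul trmxK Cp.1 /smoothing_noise_cov kN.
  have Mp := hM kN; rewrite -{1}(smoothing_cov_decomposition (F k.+1) Mp Cp).
  by rewrite mulmxA addrAC subrr add0r.
- exact: smoothing_parameters_posdefmx hM hsm.
Qed.

End ForwardModel.

(** The formulas are proved for every backward model of the same sequence, not for one chosen model;
    the existence clause keeps this from being vacuous. *)
Theorem mainTheorem3 (R : realType) (d N : nat) (hN : (1 <= N)%N)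
    (disp : measure_display) (T : measurableType disp) (P : probability T R)
    (M F : nat -> 'M[R]_d) (eM x : nat -> T -> 'cV[R]_d)
    (hfwd : forward_markov_model P N M F eM x) :
  (exists (MB FB : nat -> 'M[R]_d) (eMB : nat -> T -> 'cV[R]_d),
     backward_markov_model P N MB FB eMB x) /\
  (forall (MB FB : nat -> 'M[R]_d) (eMB : nat -> T -> 'cV[R]_d),
     backward_markov_model P N MB FB eMB x ->
     [/\ backward_parameters N M F MB FB,
         forall w : T, noise_relation N M F MB FB (eM^~ w) (eMB^~ w)
       & explicitly_sample_equivalent N
           (forward_governs N F) (backward_governs N FB)
           (noise_relation N M F MB FB)]).
Proof.
split.
  exists (smoothing_noise_cov N M F), (smoothing_trans M F), (smoothing_noise N M F x).
  exact: smoothing_backward_model hfwd.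
move=> MB FB eMB hbwd.
have hM : forall k, (k <= N)%N -> posdefmx (M k) by case: hfwd => -[].
have hB := backward_model_parameters hN hfwd hbwd.
split; [exact: smoothing_parameters_backward hN hM hB| |exact: smoothing_sample_equivalent hN hM hB].
by move=> w; exact: (smoothing_noise_relation hN hM hB (hfwd.2 w) (hbwd.2 w)).
Qed.
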